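(* Let $f\in L^\infty(\mathbb{H}^2)$ be such that $$\int_T f\,dA=0$$ for every ideal triangle $T\subseteq\mathbb{H}^2$, where $dA$ is the hyperbolic area. Then $f=0$ (as an element of $L^\infty(\mathbb{H}^2)$, i.e. almost everywhere).
   Context: An ideal triangle in the hyperbolic plane $\mathbb{H}^2$ is the geodesic triangle whose vertices are three pairwise distinct points of the boundary at infinity $\partial\mathbb{H}^2$. It has hyperbolic area $\pi$. $L^\infty(\mathbb{H}^2)$ is taken with respect to $dA$. *)

(* Defs.v *)
From HB Require Import structures.
From mathcomp Require Import all_boot all_order all_algebra.
From mathcomp Require Import all_classical all_reals all_analysis.
From mathcomp Require Import measurable_realfun.

Set Implicit Arguments.
Unset Strict Implicit.
Unset Printing Implicit Defensive.

Import Order.TTheory GRing.Theory Num.Theory.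
Import numFieldNormedType.Exports.

Local Open Scope classical_set_scope.
Local Open Scope ring_scope.

(* R^2 with its Borel sigma-algebra. *)
Notation plane R := (measurableTypeR R * measurableTypeR R)%type.

(* The hyperbolic plane in the upper half-plane model: a pair (x, y) with
   y > 0 stands for x + iy. *)
Definition hplane (R : realType) : set (plane R) := [set z | 0 < z.2].

(* Boundary at infinity of the model, R u {oo}; None is the point oo. *)
Definition ideal_point (R : realType) := option R.

(* For p != q, the zero set of [geodesic_fun p q] in the upper half-plane is
   the geodesic with ends p and q: the half-circle with diameter [a, b], or the
   vertical half-line over a.  The value on the pair (None, None) is junk. *)
Definition geodesic_fun (R : realType) (p q : ideal_point R) (z : plane R) : R :=
  match p, q with
  | Some a, Some b => (z.1 - a) * (z.1 - b) + z.2 ^+ 2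
  | Some a, None | None, Some a => z.1 - a
  | None, None => 0
  end.

(* Sign of [geodesic_fun p q] near the ideal point r, for r distinct from p
   and q.  If r = oo, then p and q are finite and oo lies outside the
   half-circle, where the function is positive. *)
Definition ideal_side (R : realType) (p q r : ideal_point R) : R :=
  match r with
  | Some c => geodesic_fun p q (c, 0)
  | None => 1
  end.

(* Closed half-plane bounded by the geodesic with ends p and q, on the side of
   the ideal point r. *)
Definition half_plane (R : realType) (p q r : ideal_point R) : set (plane R) :=
  [set z | hplane z /\ 0 <= ideal_side p q r * geodesic_fun p q z].

(* The closed region bounded by the three geodesics joining p, q and r. *)
Definition ideal_triangle (R : realType) (p q r : ideal_point R) :
    set (plane R) :=
  half_plane p q r `&` half_plane q r p `&` half_plane r p q.

Definition is_ideal_triangle (R : realType) (T : set (plane R)) : Prop :=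
  exists p q r : ideal_point R,
    [/\ p <> q, q <> r, p <> r & T = ideal_triangle p q r].

(* The hyperbolic area dx dy / y^2, as a measure on the plane carried by the upper
   half-plane: L^oo of this measure is L^oo of the hyperbolic plane, and the
   values of a function outside [hplane] play no role. *)
Definition hyp_area (R : realType) (A : set (plane R)) : \bar R :=
  (\int[lebesgue_measure \x lebesgue_measure]_(z in A `&` @hplane R)
     ((z.2 ^+ 2)^-1)%:E)%E.

Lemma measurable_hplane (R : realType) : measurable (@hplane R).
Proof.
have -> : @hplane R = [set: measurableTypeR R] `*` `]0, +oo[.
  by apply/seteqP; split=> z /=; rewrite in_itv /= andbT // => -[].
exact: measurableX.
Qed.

Section hyp_area_measure.
Context (R : realType).

Let dens (z : plane R) : \bar R := ((z.2 ^+ 2)^-1)%:E.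

Let measurable_dens : measurable_fun [set: plane R] dens.
Proof.
apply/measurable_EFinP.
have -> : (fun z : plane R => (z.2 ^+ 2)^-1) =
          ((@powR R)^~ (-1)) \o ((fun y : R => y ^+ 2) \o snd).
  by apply/funext => z /=; rewrite powR_inv1 ?sqr_ge0.
apply: measurableT_comp; first exact: measurable_powR.
by apply: measurableT_comp => //; exact: measurable_funX.
Qed.

Let dens_ge0 z : (0 <= dens z)%E.
Proof. by rewrite lee_fin invr_ge0 sqr_ge0. Qed.

Let hyp_area0 : @hyp_area R set0 = 0%E.
Proof. by rewrite /hyp_area set0I integral_set0. Qed.

Let hyp_area_ge0 A : (0 <= @hyp_area R A)%E.
Proof. by apply: integral_ge0 => z _; exact: dens_ge0. Qed.

Let hyp_area_sigma_additive : semi_sigma_additive (@hyp_area R).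
Proof.
move=> F mF tF mUF; rewrite /hyp_area setI_bigcupl.
rewrite (@ge0_integral_bigcup _ _ _ _ _ dens).
- apply: is_cvg_ereal_nneg_natsum_cond => n _ _.
  by apply: integral_ge0 => z _; exact: dens_ge0.
- by move=> n; apply: measurableI => //; exact: measurable_hplane.
- exact: measurable_funTS.
- by move=> z _; exact: dens_ge0.
- exact: trivIset_setIr.
Qed.

HB.instance Definition _ := isMeasure.Build _ _ _ (@hyp_area R)
  hyp_area0 hyp_area_ge0 hyp_area_sigma_additive.

End hyp_area_measure.

(* Main.v *)
From HB Require Import structures.
Require Import Defs.
From mathcomp Require Import all_boot all_order all_algebra.
From mathcomp Require Import all_classical all_reals all_analysis.
From mathcomp Require Import measurable_realfun ess_sup_inf ring lra.

(** Triangles with a vertex at infinity suffice.  The ideal triangle with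
vertices [c - r], [c + r] and [oo] is
<<
  { (x, y) | y > 0, (x - c)^2 <= r^2 <= (x - c)^2 + y^2 },
>>
so the hypothesis says that [f dA] has integral zero over each of these sets.
Superposing them with respect to [s = r^2] with the density [l * exp (- l * s)]
integrates [s] out and leaves the test functions
<<
  exp (- l * (x - c)^2) * (1 - exp (- l * y^2)).
>>
Superposing once more with respect to [c], with a Gaussian density, convolves
the first factor with a Gaussian and does not touch the second one.  By
completing squares (lemma [gaussM]) the product is a test function in which the
variables are separated and the two rates are independent of each other:
<<
  exp (- a * (x - m)^2) * (1 - exp (- b * y^2)),      0 < a < b, m real.
>>
Both superpositions are exchanges of integrals (lemma [integral_mixture_eq0]);
they are legitimate because [f] is bounded and such a test function is
integrable for [dA = dx dy / y^2]: near [y = 0] it is of order [y^2].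

What remains is a moment problem on [0, 1], solved by
[integral_superlevel_eq0]: a function whose products with all large powers
of [q] have integral zero has integral zero on each set [s <= q].  Differences
in [b] give all large powers of [exp (- y^2)], hence the sets [y <= d]; then the
products of Gaussians give the powers of [exp (- (x - m)^2)], hence the sets
[|x - m| <= r].  So the integrable function
[f * exp (- x^2) * (1 - exp (- y^2)) / y^2] has integral zero over all boxes, and
it vanishes almost everywhere since the boxes form a pi-system generating the
Borel sets of the plane. *)

Set Implicit Arguments.
Unset Strict Implicit.
Unset Printing Implicit Defensive.

Import Order.TTheory GRing.Theory Num.Theory.
Import numFieldNormedType.Exports.
Import HBNNSimple.

Local Open Scope classical_set_scope.
Local Open Scope ring_scope.

(** * A moment problem on the unit interval *)

Section Moments.
Context (R : realType).
Implicit Types (s t q : R).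

Lemma ler_XnB1 t k : 0 <= t <= 1 -> (1 - t) ^+ k * (1 + k%:R * t) <= 1.
Proof.
move=> /andP[t0 t1]; elim: k => [|k IH]; first by rewrite expr0; lra.
apply: le_trans IH; rewrite exprS -mulrA mulrCA ler_wpM2l//.
  by rewrite exprn_ge0//; lra.
have := ler0n R k; rewrite -natr1; nra.
Qed.

Lemma bernoulli_le t k : 0 <= t <= 1 -> 1 - (1 - t) ^+ k <= k%:R * t.
Proof.
move=> /andP[t0 t1]; elim: k => [|k IH]; first by rewrite expr0; lra.
have : (1 - t) ^+ k <= 1 by rewrite exprn_ile1//; lra.
by rewrite exprS -natr1; nra.
Qed.

(** With [r] the square root of [t], one factor [r ^+ n] absorbs [n] by the
Bernoulli-type bound [ler_XnB1] and the other one tends to zero. *)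
Lemma cvg_natmulX t : 0 <= t < 1 -> (fun n : nat => n%:R * t ^+ n) @ \oo --> 0.
Proof.
move=> /andP[t0 t1].
pose r := Num.sqrt t.
have r0 : 0 <= r by rewrite sqrtr_ge0.
have rr : r * r = t by rewrite -expr2 sqr_sqrtr.
have r1 : r < 1 by nra.
apply: (@squeeze_cvgr _ _ _ _ (fun=> 0) (geometric (1 - r)^-1 r)).
- near=> n; rewrite mulr_ge0 ?exprn_ge0//= -rr exprMn mulrA mulrC.
  rewrite [leRHS]mulrC ler_wpM2l ?exprn_ge0// -[leRHS]mul1r ler_pdivlMr ?subr_gt0//.
  have : r ^+ n * (1 + n%:R * (1 - r)) <= 1.
    have /(@ler_XnB1 _ n) : 0 <= 1 - r <= 1 by lra.
    by rewrite subKr.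
  have := exprn_ge0 n r0; lra.
- exact: cvg_cst.
- by apply: cvg_geometric; rewrite ger0_norm.
Unshelve. all: by end_near. Qed.

(** The exponent [k] must satisfy [k * s ^+ m -> +oo] and [k * q ^+ m -> 0] for
[q < s]; a rounding of [m / s ^+ m] does, and the factor [m] puts the point
[q = s] itself on the upper side of the step. *)
Definition step_exponent s m := (Num.trunc (m%:R * s ^- m)).+1.

(** For [t = q ^+ m] and [k] the step exponent, [(1 - t) ^+ k] lies between
[1 - k * t] and [1 / (1 + k * t)], so that its limit is decided by the limit of
[k * q ^+ m]. *)
Lemma step_cvg s q : 0 < s <= 1 -> 0 <= q <= 1 ->
  (fun m : nat => 1 - (1 - q ^+ m) ^+ step_exponent s m) @ \oo -->
  ((s <= q)%R%:R : R).
Proof.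
move=> /andP[s0 s1] /andP[q0 q1].
have tE m : 0 <= q ^+ m <= 1 by rewrite exprn_ge0// exprn_ile1.
have sm m : 0 < s ^+ m by rewrite exprn_gt0.
have bnd m : m%:R <= (step_exponent s m)%:R * s ^+ m <= m%:R + s ^+ m.
  have u0 : 0 <= m%:R * s ^- m by rewrite mulr_ge0// invr_ge0 ltW.
  have /andP[h1 h2] := truncn_itv u0.
  rewrite /step_exponent; apply/andP; split.
    by rewrite -ler_pdivrMr// ltW.
  by rewrite -natr1 mulrDl mul1r lerD2r -ler_pdivlMr.
have [sq|qs] := leP s q.
- rewrite -[X in _ --> X]subr0; apply: cvgB; first exact: cvg_cst.
  apply: (@squeeze_cvgr _ _ _ _ (fun=> 0) (fun m => m.+1%:R^-1)).
  + near=> m; have /andP[t0 t1] := tE m.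
    rewrite exprn_ge0 ?subr_ge0//= -[leRHS]mul1r ler_pdivlMr ?ltr0n//.
    apply: (le_trans _ (ler_XnB1 (step_exponent s m) (tE m))).
    rewrite ler_wpM2l ?exprn_ge0 ?subr_ge0// -natr1 addrC lerD2l.
    have /andP[h1 _] := bnd m; apply: (le_trans h1).
    by rewrite ler_wpM2l// lerXn2r// nnegrE// ltW.
  + exact: cvg_cst.
  + exact: cvg_harmonic.
- have qs1 : 0 <= q / s < 1.
    by rewrite divr_ge0 ?(ltW s0)// ltr_pdivrMr// mul1r.
  apply: (@squeeze_cvgr _ _ _ _ (fun=> 0)
    (fun m => m%:R * (q / s) ^+ m + q ^+ m)).
  + near=> m; have /andP[t0 t1] := tE m.
    apply/andP; split; first by rewrite subr_ge0 exprn_ile1//; lra.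
    apply: (le_trans (bernoulli_le _ (tE m))).
    have /andP[_ h2] := bnd m.
    have -> : q ^+ m = s ^+ m * (q / s) ^+ m.
      by rewrite -exprMn mulrC divfK ?gt_eqF.
    rewrite mulrA -mulrDl ler_wpM2r// exprn_ge0//.
    by have /andP[] := qs1.
  + exact: cvg_cst.
  + rewrite -[X in _ --> X](addr0 0); apply: cvgD; first exact: cvg_natmulX.
    by apply: cvg_expr; rewrite ger0_norm//; lra.
Unshelve. all: by end_near. Qed.

End Moments.

Section SuperLevel.
Context d (T : measurableType d) (R : realType).
Variable mu : {measure set T -> \bar R}.
Local Open Scope ereal_scope.

Lemma measurable_natr_bool (b : T -> bool) : measurable_fun setT b ->
  measurable_fun setT (fun x => (b x)%:R : R).
Proof.
move=> mb; rewrite (_ : (fun x => _) = fun x => if b x then 1%R else 0%R).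
  exact: measurable_fun_ifT.
by apply/funext => x; case: (b x).
Qed.

Lemma integrableM_le1 (f g : T -> R) : mu.-integrable setT (EFin \o f) ->
  measurable_fun setT g -> (forall x, `|g x| <= 1)%R ->
  mu.-integrable setT (EFin \o (fun x => f x * g x)%R).
Proof.
move=> fi mg g1; apply: (le_integrable measurableT _ _ fi).
- apply/measurable_EFinP; apply: measurable_funM => //.
  by apply/measurable_EFinP; exact: measurable_int fi.
- by move=> x _ /=; rewrite lee_fin normrM ler_piMr.
Qed.

(** The polynomials [1 - (1 - q ^+ m) ^+ k] approximate the step function of
[step_cvg] boundedly, and have only monomials of degree at least [m]; this is why the
moments from some rank [N] on suffice. *)
Lemma integral_superlevel_eq0 (f q : T -> R) (N : nat) (s : R) :
  mu.-integrable setT (EFin \o f) -> measurable_fun setT q ->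
  (forall x, 0 <= q x <= 1)%R -> (0 < s <= 1)%R ->
  (forall n, (N <= n)%N -> \int[mu]_x (f x * q x ^+ n)%:E = 0) ->
  \int[mu]_x (f x * (s <= q x)%R%:R)%:E = 0.
Proof.
move=> fi mq q01 s01 fq0.
have mX (n : nat) : measurable_fun setT (fun x => q x ^+ n)%R.
  exact: measurable_funX.
have X01 n x : (0 <= q x ^+ n <= 1)%R.
  by have /andP[a b] := q01 x; rewrite exprn_ge0// exprn_ile1.
have mC (m k : nat) : measurable_fun setT (fun x => (1 - q x ^+ m) ^+ k)%R.
  by apply: measurable_funX; apply: measurable_funB.
have C01 m k x : (0 <= (1 - q x ^+ m) ^+ k <= 1)%R.
  have /andP[a b] := X01 m x.
  by rewrite exprn_ge0 ?exprn_ile1// ?subr_ge0// lerBlDr lerDl.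
have iXC m n k :
    mu.-integrable setT (EFin \o (fun x => f x * (q x ^+ n * (1 - q x ^+ m) ^+ k))%R).
  apply: integrableM_le1 => //; first exact: measurable_funM.
  move=> x; have /andP[a b] := X01 n x; have /andP[u v] := C01 m k x.
  by rewrite ger0_norm ?mulr_ge0// mulr_ile1.
(* Induction on [k], since the factor [1 - q ^+ m] shifts the exponent [n]. *)
have XC0 m k : forall n, (N <= n)%N ->
    \int[mu]_x (f x * (q x ^+ n * (1 - q x ^+ m) ^+ k))%:E = 0.
  elim: k => [|k IH] n Nn.
    by under eq_integral do rewrite expr0 mulr1; exact: fq0.
  transitivity (\int[mu]_x ((f x * (q x ^+ n * (1 - q x ^+ m) ^+ k))%:E -
      (f x * (q x ^+ (n + m) * (1 - q x ^+ m) ^+ k))%:E)).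
    apply: eq_integral => x _; rewrite -EFinB; congr EFin.
    by rewrite exprS exprD; ring.
  rewrite integralB//; [|exact: iXC|exact: iXC].
  by rewrite !IH ?sube0// (leq_trans Nn)// leq_addr.
have P0 m k : (N <= m)%N ->
    \int[mu]_x (f x * (1 - (1 - q x ^+ m) ^+ k))%:E = 0.
  move=> Nm; elim: k => [|k IH].
    by under eq_integral do rewrite expr0 subrr mulr0; rewrite integral0.
  transitivity (\int[mu]_x ((f x * (1 - (1 - q x ^+ m) ^+ k))%:E +
      (f x * (q x ^+ m * (1 - q x ^+ m) ^+ k))%:E)).
    apply: eq_integral => x _; rewrite -EFinD; congr EFin.
    by rewrite exprS; ring.
  rewrite integralD//; [by rewrite IH XC0// adde0| |exact: iXC].
  apply: integrableM_le1 => //; first exact: measurable_funB.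
  move=> x; have /andP[u v] := C01 m k x.
  by rewrite ger0_norm; lra.
have mf : measurable_fun setT f.
  by apply/measurable_EFinP; exact: measurable_int fi.
pose g m x := (f x * (1 - (1 - q x ^+ m) ^+ step_exponent s m))%:E.
have ms : measurable_fun setT (fun x => (s <= q x)%R%:R : R).
  by apply: measurable_natr_bool; exact: measurable_fun_ler.
have [] := @dominated_convergence _ T R mu setT measurableT g
  (fun x => (f x * (s <= q x)%R%:R)%:E) (fun x => `|f x|%:E).
- move=> m; apply/measurable_EFinP/measurable_funM => //.
  exact: measurable_funB.
- by apply/measurable_EFinP/measurable_funM.
- apply/aeW => x _; apply: cvg_EFin; first by near=> m.
  by apply: cvgM; [exact: cvg_cst|exact: step_cvg].
- exact: integrable_norm.
- apply/aeW => x m _; rewrite /g /= lee_fin normrM ler_piMr//.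
  by have /andP[u v] := C01 m (step_exponent s m) x; rewrite ger0_norm; lra.
move=> _ _ cv.
have cv0 : (fun n => \int[mu]_x g n x) @ \oo --> 0.
  apply: cvg_near_cst; exists N => // m /= Nm.
  by rewrite P0.
exact: (cvg_unique _ cv cv0).
Unshelve. all: by end_near. Qed.

End SuperLevel.

(** * Vanishing on a pi-system, and superposition of test functions *)

Section PiSystem.
Context d (T : measurableType d) (R : realType).
Variable mu : {measure set T -> \bar R}.
Local Open Scope ereal_scope.

Lemma integral_mul_indic (A : set T) (f : T -> R) :
  \int[mu]_(x in A) (f x)%:E = \int[mu]_x (f x * \1_A x)%:E.
Proof.
rewrite integral_mkcond; apply: eq_integral => x _.
by rewrite patchE indicE; case: ifP => _; rewrite ?mulr1// mulr0.
Qed.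

(** The sets on which the integral of [f] vanishes form a Dynkin system.  The
exhausting sequence [E] supplies the whole space, which [G] need not
contain. *)
Lemma ae_eq0_pi_system (G : set (set T)) (E : (set T)^nat) (f : T -> R) :
  @measurable _ T = <<s G >> -> setI_closed G ->
  (forall n, G (E n)) -> (forall x, \forall n \near \oo, E n x) ->
  mu.-integrable setT (EFin \o f) ->
  (forall A, G A -> \int[mu]_(x in A) (f x)%:E = 0) ->
  {ae mu, forall x, f x = 0%R}.
Proof.
move=> GE GI GEn Ecov fi fG0.
have mG A : G A -> measurable A by move=> GA; rewrite GE; exact: sub_gen_smallest.
have mf : measurable_fun setT f.
  by apply/measurable_EFinP; exact: measurable_int fi.
have fT0 : \int[mu]_x (f x)%:E = 0.
  pose g n x := (f x * \1_(E n) x)%:E.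
  have [] := @dominated_convergence _ T R mu setT measurableT g
    (EFin \o f) (fun x => `|f x|%:E).
  - move=> n; apply/measurable_EFinP/measurable_funM => //.
    by apply: measurable_indic; exact: mG.
  - exact/measurable_EFinP.
  - apply/aeW => x _; apply: cvg_near_cst.
    have := Ecov x; apply: filterS => n Enx.
    by rewrite /g indicE mem_set// mulr1.
  - exact: integrable_norm.
  - apply/aeW => x n _; rewrite /g /= lee_fin normrM ler_piMr//.
    by rewrite indicE; case: (_ \in _); rewrite ?normr1// normr0.
  move=> _ _ cv; apply: (cvg_unique _ cv) => //.
  apply: cvg_near_cst; exists 0%N => // n _ /=.
  by rewrite -integral_mul_indic fG0.
have f0 A : measurable A -> \int[mu]_(x in A) (f x)%:E = 0.
  move=> mA; apply: (dynkin_induction GE GI fT0 fG0); last by rewrite -GE.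
  - move=> B mB fB.
    have fTB : \int[mu]_(x in B `|` ~` B) (f x)%:E = 0 by rewrite setUv.
    rewrite integral_setU// in fTB.
    + by move: fTB; rewrite fB add0e.
    + exact: measurableC.
    + by rewrite setUv; exact/measurable_EFinP.
    + by apply/disj_setPCl.
  - move=> F mF tF fF; rewrite integral_bigcup//.
    + by rewrite eseries0// => i _ _; exact: fF.
    + by apply: (integrableS measurableT) => //; exact: bigcup_measurable.
have : ae_eq mu setT (EFin \o f) (cst 0).
  apply: integral_ae_eq => //.
  by move=> A _ mA; rewrite integral0; exact: f0.
by apply: filterS => x /(_ I) /= [].
Qed.

End PiSystem.

Section Kernel.
Context d1 d2 (T1 : measurableType d1) (T2 : measurableType d2) (R : realType).
Variable mu1 : {sigma_finite_measure set T1 -> \bar R}.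
Variable mu2 : {sigma_finite_measure set T2 -> \bar R}.
Local Open Scope ereal_scope.

(** If [f] is orthogonal to every [k (x, _)], it is orthogonal to their
superposition [K].  Since [k] is nonnegative, integrability of [f * K] is all
that is needed to exchange the integrals. *)
Lemma integral_mixture_eq0 (f K : T2 -> R) (k : T1 * T2 -> R) :
  measurable_fun setT f -> measurable_fun setT k -> (forall p, 0 <= k p)%R ->
  (forall y, \int[mu1]_x (k (x, y))%:E = (K y)%:E) ->
  mu2.-integrable setT (EFin \o (fun y => f y * K y)%R) ->
  (forall x, \int[mu2]_y (f y * k (x, y))%:E = 0) ->
  \int[mu2]_y (f y * K y)%:E = 0.
Proof.
move=> mf mk k0 kK fKi fk0.
pose g (p : T1 * T2) := (f p.2 * k p)%:E.
have mky y : measurable_fun setT (fun x => k (x, y)).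
  by apply: (measurableT_comp mk); exact: pair2_measurable.
have mg : measurable_fun setT g.
  by apply/measurable_EFinP/measurable_funM => //; exact: measurableT_comp.
have K0 y : (0 <= K y)%R.
  by rewrite -lee_fin -kK; apply: integral_ge0 => x _; rewrite lee_fin.
have iky y : mu1.-integrable setT (fun x => (k (x, y))%:E).
  apply/integrableP; split; first exact/measurable_EFinP.
  under eq_integral do rewrite /= ger0_norm//.
  by rewrite kK ltry.
have gi : (mu1 \x mu2).-integrable setT g.
  apply/integrable21ltyP => //.
  have /integrableP[_] := fKi; apply: le_lt_trans.
  rewrite le_eqVlt; apply/orP; left; apply/eqP; apply: eq_integral => y _ /=.
  under eq_integral do rewrite normrM EFinM.
  rewrite ge0_integralZl//=.
  - under eq_integral do rewrite ger0_norm//.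
    by rewrite kK normrM (ger0_norm (K0 y)).
  - by apply/measurable_EFinP/measurableT_comp.
have := Fubini gi.
rewrite [LHS]integral0_eq; last by move=> x _; exact: fk0.
move=> ->; apply: eq_integral => y _.
rewrite /g /=; under eq_integral do rewrite EFinM.
by rewrite integralZl//= kK.
Qed.

End Kernel.

(** * Integration against a measure with a density *)

Section Density.
Context d (T : measurableType d) (R : realType).
Variables (mu nu : {measure set T -> \bar R}) (w : T -> R).
Hypothesis mw : measurable_fun setT w.
Hypothesis w0 : forall x, (0 <= w x)%R.
Hypothesis nuE : forall A, measurable A ->
  nu A = (\int[mu]_(x in A) (w x)%:E)%E.
Local Open Scope ereal_scope.

Let integral_density_nnsfun (h : {nnsfun T >-> R}) :
  \int[nu]_x (h x)%:E = \int[mu]_x (h x * w x)%:E.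
Proof.
have term_ge0 y x : (0 <= y * \1_(h @^-1` [set y]) x * w x)%R.
  by rewrite mulr_ge0// -lee_fin nnfun_muleindic_ge0.
have term_meas y : measurable_fun setT (fun x => y * \1_(h @^-1` [set y]) x * w x)%R.
  by apply: measurable_funM => //; exact: measurable_funM.
rewrite integralT_nnsfun sintegralE.
transitivity (\int[mu]_x (\sum_(y \in range h)
    (y * \1_(h @^-1` [set y]) x * w x)%:E)); last first.
  apply: eq_integral => x _; rewrite fsumEFin//; congr EFin.
  by rewrite [in RHS]fimfunE mulrC mulr_fsumr; apply: eq_fsbigr => y _; ring.
rewrite ge0_integral_fsum//; last 2 first.
- by move=> y; apply/measurable_EFinP.
- by move=> y x _; rewrite lee_fin.
apply: eq_fsbigr => y /[!inE] -[t _ hty].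
have y0 : (0 <= y)%R by rewrite -hty.
have mhy : measurable (h @^-1` [set y]) by exact: measurable_sfunP.
rewrite nuE// integral_mul_indic -ge0_integralZl//.
- apply: eq_integral => x _; rewrite -EFinM; congr EFin; ring.
- by apply/measurable_EFinP; exact: measurable_funM.
- by move=> x _; rewrite lee_fin mulr_ge0.
Qed.

Lemma ge0_integral_density (f : T -> R) :
  measurable_fun setT f -> (forall x, 0 <= f x)%R ->
  \int[nu]_x (f x)%:E = \int[mu]_x (f x * w x)%:E.
Proof.
move=> mf f0.
have mEf : measurable_fun setT (EFin \o f) by exact/measurable_EFinP.
have Ef0 x : setT x -> 0 <= (EFin \o f) x by rewrite lee_fin.
pose h := nnsfun_approx measurableT mEf.
have hf x : (EFin \o h ^~ x) @ \oo --> (f x)%:E by exact: cvg_nnsfun_approx.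
have h_nd x : {homo h ^~ x : m n / (m <= n)%N >-> (m <= n)%R}.
  by move=> m n mn; apply/lefP/nd_nnsfun_approx.
have cvg_nu : (fun n => \int[nu]_x (h n x)%:E) @ \oo --> \int[nu]_x (f x)%:E.
  rewrite (_ : (fun x => (f x)%:E) = (fun x => limn (EFin \o h ^~ x))).
    apply: cvg_monotone_convergence => //.
    - by move=> n; apply/measurable_EFinP.
    - by move=> n x _; rewrite lee_fin.
    - by move=> x _ m n mn; rewrite lee_fin h_nd.
  by apply/funext => x; apply/esym/cvg_lim.
have cvg_mu : (fun n => \int[mu]_x (h n x * w x)%:E) @ \oo -->
    \int[mu]_x (f x * w x)%:E.
  rewrite (_ : (fun x => (f x * w x)%:E) =
               (fun x => limn (fun n => (h n x * w x)%:E))).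
    apply: cvg_monotone_convergence => //.
    - by move=> n; apply/measurable_EFinP/measurable_funM.
    - by move=> n x _; rewrite lee_fin mulr_ge0.
    - by move=> x _ m n mn; rewrite lee_fin ler_wpM2r// h_nd.
  apply/funext => x; apply/esym/cvg_lim => //.
  exact: (cvgeZr (y := (w x)%:E) erefl (hf x)).
apply: (cvg_unique _ cvg_nu) => //.
rewrite (_ : (fun n => _) = (fun n => \int[mu]_x (h n x * w x)%:E))//.
by apply/funext => n; exact: integral_density_nnsfun.
Qed.

(** The identity for nonnegative functions applies to the positive and to the
negative part, also when their integrals are infinite. *)
Lemma integral_density (f : T -> R) : measurable_fun setT f ->
  \int[nu]_x (f x)%:E = \int[mu]_x (f x * w x)%:E.
Proof.
move=> mf; rewrite [LHS]integralE [RHS]integralE; congr (_ - _).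
- transitivity (\int[nu]_x (f^\+%R x)%:E).
    by apply: eq_integral => x _; rewrite -[LHS]/((EFin \o f)^\+ x) funerpos.
  rewrite ge0_integral_density//; last exact: measurable_funrpos.
  apply: eq_integral => x _; rewrite -[RHS]/((EFin \o (fun x => f x * w x)%R)^\+ x).
  by rewrite funerpos/= /funrpos maxr_pMl// mul0r.
- transitivity (\int[nu]_x (f^\-%R x)%:E).
    by apply: eq_integral => x _; rewrite -[LHS]/((EFin \o f)^\- x) funerneg.
  rewrite ge0_integral_density//; last exact: measurable_funrneg.
  apply: eq_integral => x _; rewrite -[RHS]/((EFin \o (fun x => f x * w x)%R)^\- x).
  by rewrite funerneg/= /funrneg maxr_pMl// mul0r mulNr.
Qed.

End Density.

(** * Gaussians and exponentials on the line *)

Section OneDimensional.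
Context (R : realType).
Implicit Types (a b c m s x l : R).
Local Notation leb := (@lebesgue_measure R).

(** Unnormalized Gaussian: the rate [a] is half the inverse of the variance. *)
Definition gauss a m x : R := expR (- a * (x - m) ^+ 2).

Definition gauss_mass a : R := (normal_peak (Num.sqrt (a *+ 2)^-1))^-1.

Lemma gauss_gt0 a m x : 0 < gauss a m x.
Proof. exact: expR_gt0. Qed.

Lemma gauss_le1 a m x : 0 < a -> gauss a m x <= 1.
Proof.
by move=> a0; rewrite -expR0 ler_expR mulNr oppr_le0 pmulr_rge0// sqr_ge0.
Qed.

Lemma measurable_gauss a m : measurable_fun setT (gauss a m).
Proof.
apply: measurableT_comp => //; apply: measurable_funM => //.
by apply: measurable_funX; exact: measurable_funB.
Qed.

Lemma gaussC a m x : gauss a m x = gauss a x m.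
Proof. by rewrite /gauss -sqrrN opprB. Qed.

Lemma gaussX a m x n : gauss a m x ^+ n = gauss (a * n%:R) m x.
Proof. by rewrite /gauss -expRM_natl; congr expR; ring. Qed.

(** Completion of the square in [x]; the second factor no longer contains [x],
which makes the convolution of two Gaussians a Gaussian. *)
Lemma gaussM a b u m x : 0 < a + b ->
  gauss a u x * gauss b m x =
  gauss (a + b) ((a * u + b * m) / (a + b)) x * gauss (a * b / (a + b)) m u.
Proof.
by move=> ab; rewrite /gauss -!expRD; congr expR; field; rewrite gt_eqF.
Qed.

Let stdev_neq0 a : 0 < a -> Num.sqrt (a *+ 2)^-1 != 0.
Proof. by move=> a0; rewrite gt_eqF// sqrtr_gt0 invr_gt0 mulrn_wgt0. Qed.

Lemma gauss_mass_gt0 a : 0 < a -> 0 < gauss_mass a.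
Proof. by move=> a0; rewrite invr_gt0 normal_peak_gt0// stdev_neq0. Qed.

Lemma integral_gauss a m : 0 < a ->
  (\int[leb]_x (gauss a m x)%:E = (gauss_mass a)%:E)%E.
Proof.
move=> a0; set s := Num.sqrt (a *+ 2)^-1.
have s0 : s != 0 by exact: stdev_neq0.
have p0 : normal_peak s != 0 by rewrite gt_eqF// normal_peak_gt0.
have gE x : gauss a m x = gauss_mass a * normal_pdf m s x.
  rewrite normal_pdfE//= mulKf//.
  rewrite /normal_fun /gauss sqr_sqrtr ?invr_ge0 ?mulrn_wge0 ?ltW//.
  have -> : (a *+ 2)^-1 *+ 2 = a^-1.
    by rewrite -[a *+ 2]mulr_natr invfM -[LHS]mulr_natr divfK ?pnatr_eq0.
  by rewrite invrK mulNr mulrC mulNr.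
under eq_integral do rewrite gE EFinM.
rewrite integralZl//; first by rewrite integral_normal_pdf mule1.
exact: integrable_normal_pdf.
Qed.

Lemma integrable_gauss a m : 0 < a ->
  leb.-integrable setT (fun x => (gauss a m x)%:E).
Proof.
move=> a0; apply/integrableP; split.
  by apply/measurable_EFinP; exact: measurable_gauss.
under eq_integral do rewrite gee0_abs ?lee_fin ?(ltW (gauss_gt0 _ _ _))//.
by rewrite integral_gauss// ltry.
Qed.

(** The superposition of the triangles over [s = r ^+ 2]: for a given point of the
plane, the triangles containing it are those with [s] between
[a = (x - c) ^+ 2] and [b = (x - c) ^+ 2 + y ^+ 2].  The condition [0 < s]
excludes the degenerate triangle with [r = 0]. *)
Lemma integral_expR_itv l a b : 0 < l -> 0 <= a -> a <= b ->
  (\int[leb]_s (l * expR (- l * s) *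
     ((0 < s) && (a <= s <= b))%R%:R)%:E =
   (expR (- l * a) - expR (- l * b))%:E)%E.
Proof.
move=> l0 a0 ab; set f := fun s => l * expR (- l * s).
have [<-|neq_ab] := eqVneq a b.
  rewrite subrr.
  transitivity (\int[leb]_(s in [set a])
      (f s * ((0 < s) && (a <= s <= a))%R%:R)%:E)%E; last exact: integral_set1.
  rewrite [RHS]integral_mkcond; apply: eq_integral => s _.
  rewrite patchE; case: ifPn => //; rewrite notin_setE /= => /eqP sa.
  by rewrite -eq_le eq_sym (negbTE sa) andbF mulr0.
have {neq_ab}ab : a < b by rewrite lt_neqAle neq_ab.
pose F s : R := - expR (- l * s).
have dF s : is_derive s 1 F (f s).
  rewrite /F /f; apply: is_derive_eq.
  by rewrite -[(- l)%:A]/(- l * 1); ring.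
have cf : continuous f.
  move=> s; apply: cvgM; first exact: cvg_cst.
  by apply: (cvg_comp _ expR); [exact: mulrl_continuous|exact: continuous_expR].
have cF : continuous F.
  by move=> s; apply/differentiable_continuous/derivable1_diffP; apply: ex_derive.
have -> : (expR (- l * a) - expR (- l * b))%:E = ((F b)%:E - (F a)%:E)%E.
  by rewrite -EFinB /F opprK addrC.
have <- : (\int[leb]_(s in `[a, b]) (f s)%:E = (F b)%:E - (F a)%:E)%E.
  apply: continuous_FTC2 => //.
  - exact: continuous_subspaceT.
  - split.
    + by move=> x _; exact: ex_derive.
    + by apply: cvg_at_right_filter; exact: cF.
    + by apply: cvg_at_left_filter; exact: cF.
  - by move=> x _; rewrite derive1E; exact: derive_val.
have fi : leb.-integrable `]a, b] (EFin \o f).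
  apply: (@integrableS _ _ _ leb `[a, b]) => //.
    exact: subset_itv_oc_cc.
  apply: continuous_compact_integrable; first exact: segment_compact.
  exact: continuous_subspaceT.
have [a_eq0|a_neq0] := eqVneq a 0.
- rewrite -integral_itv_obnd_cbnd; last exact: measurable_int fi.
  rewrite [RHS]integral_mkcond; apply: eq_integral => s _.
  rewrite patchE mem_setE in_itv /= a_eq0.
  by have [s0|s0] := ltP 0 s; rewrite /= ?mulr0// (ltW s0)/=;
    case: ifP; rewrite ?mulr1 ?mulr0.
- have {a_neq0}a0 : 0 < a by rewrite lt_neqAle eq_sym a_neq0.
  rewrite [RHS]integral_mkcond; apply: eq_integral => s _.
  rewrite patchE mem_setE in_itv /=.
  have [as_|sa] := leP a s; rewrite /= ?andbF ?mulr0//.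
  by rewrite (lt_le_trans a0 as_)/=; case: ifP; rewrite ?mulr1 ?mulr0.
Qed.

Lemma integrable_oneDsqrV :
  leb.-integrable setT (fun x => ((1 + x ^+ 2)^-1)%:E).
Proof.
apply/integrableP; split.
  apply/measurable_EFinP; apply: continuous_measurable_fun => x.
  exact: continuous_oneDsqrV.
under eq_integral do rewrite /= ger0_norm ?invr_ge0 ?addr_ge0 ?sqr_ge0//.
rewrite ge0_symfun_integralT.
- rewrite -set_itvcy [X in (_ * X)%E](integral0y_oneDsqr R).
  by rewrite -EFinM ltry.
- by move=> x; rewrite invr_ge0 addr_ge0// sqr_ge0.
- by move=> x; exact: continuous_oneDsqrV.
- by move=> x /=; rewrite sqrrN.
Qed.

End OneDimensional.

(** * The plane: Lebesgue measure, triangles at infinity, integrability *)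

Section LebesguePlane.
Context (R : realType).
Local Open Scope ereal_scope.

(** A name for the planar Lebesgue measure, which carries its own sigma-finite
structure, so that it can be a factor of a further product measure. *)
Definition lebesgue2 : set (plane R) -> \bar R :=
  (@lebesgue_measure R) \x (@lebesgue_measure R).

HB.instance Definition _ := Measure.copy lebesgue2
  ((@lebesgue_measure R) \x (@lebesgue_measure R)).

Let lebesgue2_sigma_finite : sigma_finite setT lebesgue2.
Proof.
have leb_fin n : (@lebesgue_measure R) `[(- n%:R)%R, n%:R%R]%classic < +oo.
  by rewrite lebesgue_measure_itv/=; case: ifP; rewrite ?ltry// -EFinB ltry.
exists (fun n => `[(- n%:R)%R, n%:R%R]%classic `*` `[(- n%:R)%R, n%:R%R]%classic).
  apply/seteqP; split=> // -[x y] _.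
  exists (Num.trunc (Num.max `|x| `|y|)%R).+1 => //.
  have := truncnS_gt (Num.max `|x| `|y|)%R.
  by rewrite gt_max => /andP[/ltW + /ltW +]; rewrite !ler_norml /= !in_itv.
move=> n; split; first exact: measurableX.
rewrite /lebesgue2 product_measure1E//; have := leb_fin n => lt_n.
by apply: lte_mul_pinfty; rewrite ?ge0_fin_numE.
Qed.

HB.instance Definition _ :=
  Measure_isSigmaFinite.Build _ _ _ lebesgue2 lebesgue2_sigma_finite.

End LebesguePlane.

Section Plane.
Context (R : realType).
Implicit Types (a b c m r s : R) (z : plane R).
Local Notation leb := (@lebesgue_measure R).
Local Notation leb2 := (@lebesgue2 R).

Lemma ideal_triangle_oo c r : 0 < r ->
  ideal_triangle (Some (c - r)) (Some (c + r)) None =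
  [set z : plane R | 0 < z.2 /\ (z.1 - c) ^+ 2 <= r ^+ 2 <= (z.1 - c) ^+ 2 + z.2 ^+ 2].
Proof.
move=> r0; apply/seteqP; split=> z.
- move=> [[[z0 /= h1] [_ /= h2]] [_ /= h3]]; split=> //.
  have h4 : z.1 - c <= r by nra.
  have h5 : - r <= z.1 - c by nra.
  by apply/andP; split; nra.
- move=> /= [z0 /andP[h1 h2]].
  have /andP[h3 h4] : - r <= z.1 - c <= r.
    by rewrite -ler_norml -(ger0_norm (ltW r0)) -ler_sqr ?nnegrE// !real_normK ?num_real.
  split; [split|]; split=> //=.
  + by nra.
  + by nra.
  + by nra.
Qed.

Lemma measurable_ideal_triangle_oo c r : 0 < r ->
  measurable (ideal_triangle (Some (c - r)) (Some (c + r)) None).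
Proof.
move=> r0; rewrite ideal_triangle_oo//.
have measurable_z1 : measurable_fun setT (fun z : plane R => z.1 : R).
  exact: measurable_fst.
have measurable_z2 : measurable_fun setT (fun z : plane R => z.2 : R).
  exact: measurable_snd.
have mx : measurable_fun setT (fun z => (z.1 - c) ^+ 2).
  by apply: measurable_funX; exact: measurable_funB.
have mxy : measurable_fun setT (fun z => (z.1 - c) ^+ 2 + z.2 ^+ 2).
  by apply: measurable_funD => //; exact: measurable_funX.
have mb : measurable_fun setT (fun z =>
    (0 < z.2) && ((z.1 - c) ^+ 2 <= r ^+ 2 <= (z.1 - c) ^+ 2 + z.2 ^+ 2)).
  apply: measurable_and; first exact: measurable_fun_ltr.
  by apply: measurable_and; exact: measurable_fun_ler.
rewrite (_ : [set _ | _] = setT `&` (fun z => (0 < z.2) &&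
    ((z.1 - c) ^+ 2 <= r ^+ 2 <= (z.1 - c) ^+ 2 + z.2 ^+ 2)) @^-1` [set true]).
  exact: mb.
by rewrite setTI; apply/seteqP; split=> z /=; [case=> -> ->|case/andP].
Qed.

(** The dominating function is a product of integrable functions of one
variable. *)
Lemma integrable_gauss_decay (a m B : R) (g : plane R -> R) : 0 < a ->
  measurable_fun setT g ->
  (forall z, `|g z| <= B * (gauss a m z.1 * (1 + z.2 ^+ 2)^-1)) ->
  leb2.-integrable setT (EFin \o g).
Proof.
move=> a0 mg gB.
pose h z := gauss a m z.1 * (1 + z.2 ^+ 2)^-1.
have mV : measurable_fun setT (fun y : R => (1 + y ^+ 2)^-1).
  by apply/measurable_EFinP; exact: measurable_int (integrable_oneDsqrV R).
have mgs : measurable_fun setT (gauss a m) by exact: measurable_gauss.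
have mh : measurable_fun setT h.
  apply: measurable_funM; first exact: (measurableT_comp mgs measurable_fst).
  exact: (measurableT_comp mV measurable_snd).
have V0 (y : R) : 0 <= (1 + y ^+ 2)^-1 by rewrite invr_ge0 addr_ge0 ?sqr_ge0.
have hi : leb2.-integrable setT (EFin \o h).
  apply/integrable12ltyP; first exact/measurable_EFinP.
  pose V := fine (\int[leb]_y ((1 + y ^+ 2)^-1)%:E)%E.
  have VE : (\int[leb]_y ((1 + y ^+ 2)^-1)%:E = V%:E)%E.
    by rewrite fineK// (integrable_fin_num measurableT (integrable_oneDsqrV R)).
  have inner x : (\int[leb]_y `|(h (x, y))%:E| = V%:E * (gauss a m x)%:E)%E.
    rewrite muleC -VE -integralZl//; last exact: integrable_oneDsqrV.
    apply: eq_integral => y _; rewrite /h /= ger0_norm ?EFinM//.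
    by rewrite mulr_ge0// ltW// gauss_gt0.
  under eq_integral do rewrite inner.
  rewrite ge0_integralZl_EFin//.
  - by rewrite integral_gauss// -EFinM ltry.
  - by move=> x _; rewrite lee_fin ltW// gauss_gt0.
  - exact/measurable_EFinP.
  - by rewrite fine_ge0// integral_ge0// => y _; rewrite lee_fin.
apply: (le_integrable measurableT _ _ (integrableZl measurableT B hi)).
  exact/measurable_EFinP.
move=> z _ /=; rewrite lee_fin; apply: le_trans (gB z) _.
exact: ler_norm.
Qed.

End Plane.

(** * Boxes generate the Borel sets of the plane *)

Section Boxes.
Context (R : realType).
Implicit Types (a b d : R).

(** Unbounded below in the second coordinate, because they will be met as
superlevel sets of [gauss 1 0 z.2] on the upper half-plane. *)
Definition boxes : set (set (plane R)) :=
  [set A | exists a b d, A = [set z | (a <= z.1 <= b) && (z.2 <= d)]].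

Lemma boxes_setI_closed : setI_closed boxes.
Proof.
move=> _ _ [a [b [d ->]]] [a' [b' [d' ->]]].
exists (Num.max a a'), (Num.min b b'), (Num.min d d').
apply/seteqP; split=> z /=; rewrite ge_max !le_min.
- by move=> [/andP[/andP[-> ->] ->] /andP[/andP[-> ->] ->]].
- by move=> /andP[/andP[/andP[-> ->] /andP[-> ->]] /andP[-> ->]].
Qed.

Definition square n : set (plane R) :=
  [set z | (- n%:R <= z.1 <= n%:R) && (z.2 <= n%:R)].

Lemma square_cover z : \forall n \near \oo, square n z.
Proof.
near=> n; have : Num.max `|z.1| `|z.2| <= n%:R.
  by near: n; exact: nbhs_infty_ger.
rewrite ge_max => /andP[]; rewrite !ler_norml => -/andP[h1 h2] /andP[_ h3].
by rewrite /square /= h1 h2 h3.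
Unshelve. all: by end_near. Qed.

Lemma measurable_boxes : @measurable _ (plane R) = <<s boxes >>.
Proof.
pose T := g_sigma_algebraType boxes.
have mbox a b d : measurable ([set z | (a <= z.1 <= b) && (z.2 <= d)] : set T).
  by apply: sub_sigma_algebra; exists a, b, d.
have mright b : measurable ([set z | b < z.1] : set T).
  rewrite (_ : [set z | b < z.1] =
      ~` \bigcup_n [set z | (- n%:R <= z.1 <= b) && (z.2 <= n%:R)]).
    by apply: measurableC; apply: bigcup_measurable => n _; exact: mbox.
  apply/seteqP; split=> z /=.
  - by move=> bz [n _ /= /andP[/andP[_]]]; rewrite leNgt bz.
  - move=> nz; rewrite ltNge; apply/negP => zb; apply: nz.
    have [n _ /(_ n (leqnn n))] := square_cover z.
    by move=> /andP[/andP[h1 h2] h3]; exists n => //=; rewrite h1 zb h3.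
have mup d : measurable ([set z | d < z.2] : set T).
  rewrite (_ : [set z | d < z.2] =
      ~` \bigcup_n [set z | (- n%:R <= z.1 <= n%:R) && (z.2 <= d)]).
    by apply: measurableC; apply: bigcup_measurable => n _; exact: mbox.
  apply/seteqP; split=> z /=.
  - by move=> bz [n _ /= /andP[_]]; rewrite leNgt bz.
  - move=> nz; rewrite ltNge; apply/negP => zb; apply: nz.
    have [n _ /(_ n (leqnn n))] := square_cover z.
    by move=> /andP[/andP[h1 h2] h3]; exists n => //=; rewrite h1 h2 zb.
have m1 : measurable_fun [set: T] (fst : T -> measurableTypeR R).
  apply: (measurability _ (RGenOInfty.measurableE R)) => _ [_ [b ->] <-].
  rewrite setTI (_ : _ @^-1` _ = [set z | b < z.1]); first exact: mright.
  by apply/seteqP; split=> z /=; rewrite in_itv/= andbT.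
have m2 : measurable_fun [set: T] (snd : T -> measurableTypeR R).
  apply: (measurability _ (RGenOInfty.measurableE R)) => _ [_ [b ->] <-].
  rewrite setTI (_ : _ @^-1` _ = [set z | b < z.2]); first exact: mup.
  by apply/seteqP; split=> z /=; rewrite in_itv/= andbT.
have mid : measurable_fun [set: T] (id : T -> plane R).
  rewrite (_ : id = fun z : T => (z.1, z.2)); last by apply/funext => -[].
  exact: measurable_fun_pair.
apply/seteqP; split=> A mA.
  by have := mid measurableT A mA; rewrite setTI.
apply: (smallest_sub _ _ mA); first exact: sigma_algebra_measurable.
move=> _ [a [b [d ->]]].
rewrite (_ : [set _ | _] = `[a, b]%classic `*` `]-oo, d]%classic).
  exact: measurableX.
apply/seteqP; split=> z /=; rewrite !in_itv/=.
- by move=> /andP[].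
- by move=> [-> ->].
Qed.

End Boxes.

(** * From triangles to boxes *)

Section Transform.
Context (R : realType).
Implicit Types (a b c l m r s : R) (z : plane R).
Local Notation leb := (@lebesgue_measure R).
Local Notation leb2 := (@lebesgue2 R).

Local Notation tri c r := (ideal_triangle (Some (c - r)%R) (Some (c + r)%R) None).

(** In this section [F] stands for [f / y ^+ 2] on the upper half-plane, so that
integrals of [f] for the hyperbolic area are planar integrals of [F]. *)
Variables (F : plane R -> R) (C : R).
Hypothesis mF : measurable_fun setT F.
Hypothesis F0 : forall z, z.2 <= 0 -> F z = 0.
Hypothesis FC : forall z, 0 < z.2 -> `|F z| <= C / z.2 ^+ 2.
Hypothesis triF : forall c r, 0 < r ->
  (\int[leb2]_(z in tri c r) (F z)%:E = 0)%E.

Let C0 : 0 <= C.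
Proof.
have := FC (z := (0, 1)) ltr01; rewrite expr1n divr1.
by apply: le_trans; exact: normr_ge0.
Qed.

Let measurable_z1 : measurable_fun setT (fun z => z.1 : R).
Proof. exact: measurable_fst. Qed.

Let measurable_z2 : measurable_fun setT (fun z => z.2 : R).
Proof. exact: measurable_snd. Qed.

Definition height_factor (b y : R) : R := 1 - gauss b 0 y.

Let measurable_height_factor b : measurable_fun setT (fun z => height_factor b z.2).
Proof.
apply: measurable_funB => //.
exact: (measurableT_comp (measurable_gauss b 0) measurable_snd).
Qed.

Let measurable_gauss1 a m : measurable_fun setT (fun z => gauss a m z.1).
Proof. exact: (measurableT_comp (measurable_gauss a m) measurable_fst). Qed.

(** The height factor is of order [y ^+ 2] near the boundary at infinity, which
cancels the singularity of the hyperbolic area. *)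
Lemma height_factor_bound b y : 0 < b -> 0 < y ->
  0 <= height_factor b y /\ height_factor b y / y ^+ 2 <= (1 + b) / (1 + y ^+ 2).
Proof.
move=> b0 y0; have y20 : 0 < y ^+ 2 by rewrite exprn_gt0.
have h0 : 0 <= height_factor b y.
  by rewrite subr_ge0 gauss_le1.
split=> //; rewrite ler_pdivrMr// mulrAC ler_pdivlMr ?addr_gt0//.
have h1 : height_factor b y <= 1 by rewrite gerBl ltW// gauss_gt0.
have := expR_ge1Dx (- b * y ^+ 2).
by rewrite /height_factor /gauss subr0 in h0 h1 * => h2; nra.
Qed.

Lemma integrable_testM a m b (u : plane R -> R) : 0 < a -> 0 < b ->
  measurable_fun setT u -> (forall z, `|u z| <= 1) ->
  leb2.-integrable setT (EFin \o
    (fun z => F z * (gauss a m z.1 * height_factor b z.2) * u z)).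
Proof.
move=> a0 b0 mu u1.
apply: (@integrable_gauss_decay R a m (C * (1 + b))) => //.
  by apply: measurable_funM => //; apply: measurable_funM => //; exact: measurable_funM.
move=> z; have [z0|z0] := leP z.2 0.
  rewrite F0// !mul0r normr0 mulr_ge0//.
    by rewrite mulr_ge0// addr_ge0// ltW.
  by rewrite mulr_ge0 ?ltW ?gauss_gt0// invr_gt0 ltr_wpDr ?sqr_ge0.
have [h0 h1] := height_factor_bound b0 z0.
rewrite normrM -[leRHS]mulr1; apply: ler_pM => //.
rewrite normrM (ger0_norm (mulr_ge0 (ltW (gauss_gt0 _ _ _)) h0)).
apply: (le_trans (ler_wpM2r _ (FC z0))).
  by rewrite mulr_ge0// ltW// gauss_gt0.
rewrite [leRHS](_ : _ = C * (gauss a m z.1 * ((1 + b) / (1 + z.2 ^+ 2)))); last by ring.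
rewrite [leLHS](_ : _ = C * (gauss a m z.1 * (height_factor b z.2 / z.2 ^+ 2))); last by ring.
by rewrite !ler_wpM2l// ltW// gauss_gt0.
Qed.

Lemma integrable_test a m b : 0 < a -> 0 < b ->
  leb2.-integrable setT (EFin \o
    (fun z => F z * (gauss a m z.1 * height_factor b z.2))).
Proof.
move=> a0 b0; apply: (eq_integrable measurableT _ _ _
  (@integrable_testM a m b (cst 1) a0 b0 _ _)) => //.
- by move=> z _ /=; rewrite mulr1.
- by move=> z /=; rewrite normr1.
Qed.

(** Superposition of the triangles with the ends [c - r] and [c + r] over all
[r], with [s = r ^+ 2] exponentially distributed. *)
Lemma integral_radial_eq0 l c : 0 < l ->
  (\int[leb2]_z (F z * (gauss l c z.1 * height_factor l z.2))%:E = 0)%E.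
Proof.
move=> l0.
pose k (p : R * plane R) := l * expR (- l * p.1) *
  ((0 < p.1) && ((p.2.1 - c) ^+ 2 <= p.1 <= (p.2.1 - c) ^+ 2 + p.2.2 ^+ 2))%R%:R.
have m1 : measurable_fun setT (fun p : R * plane R => p.1 : R) by exact: measurable_fst.
have m21 : measurable_fun setT (fun p : R * plane R => p.2.1 : R).
  exact: (measurableT_comp measurable_fst measurable_snd).
have m22 : measurable_fun setT (fun p : R * plane R => p.2.2 : R).
  exact: (measurableT_comp measurable_snd measurable_snd).
have mx : measurable_fun setT (fun p : R * plane R => (p.2.1 - c) ^+ 2).
  by apply: measurable_funX; exact: measurable_funB.
apply: (@integral_mixture_eq0 _ _ (measurableTypeR R) (plane R) R leb leb2 F
  (fun z => gauss l c z.1 * height_factor l z.2) k) => //.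
- apply: measurable_funM.
    apply: measurable_funM => //; apply: measurableT_comp => //.
    exact: measurable_funM.
  apply: measurable_natr_bool.
  apply: measurable_and; first exact: measurable_fun_ltr.
  apply: measurable_and; first exact: measurable_fun_ler.
  apply: measurable_fun_ler => //.
  by apply: measurable_funD => //; exact: measurable_funX.
- by move=> p; rewrite mulr_ge0// mulr_ge0 ?expR_ge0// ltW.
- move=> z; rewrite /k /= integral_expR_itv ?sqr_ge0 ?lerDl ?sqr_ge0//.
  by congr EFin; rewrite /height_factor /gauss subr0 mulrDr expRD; ring.
- exact: integrable_test.
- move=> s; have [s0|s0] := leP s 0.
    by apply: integral0_eq => z _; rewrite /k /= ltNge s0 mulr0 mulr0.
  have rs0 : 0 < Num.sqrt s by rewrite sqrtr_gt0.
  have := triF c rs0; rewrite integral_mul_indic => T0.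
  transitivity (\int[leb2]_z ((l * expR (- l * s))%:E * (F z *
      \1_(tri c (Num.sqrt s)) z)%:E))%E.
    apply: eq_integral => z _; rewrite -EFinM; congr EFin.
    have [z0|z0] := leP z.2 0; first by rewrite F0// !(mul0r,mulr0).
    rewrite /k /= s0 /= mulrCA; congr (_ * (_ * _)).
    rewrite ideal_triangle_oo// indicE; congr ((nat_of_bool _)%:R).
    rewrite sqr_sqrtr ?(ltW s0)//.
    by apply/idP/idP => [h|/set_mem[]//]; exact/mem_set.
  rewrite integralZl ?T0 ?mule0//.
  (* A function whose integral is a real number is integrable. *)
  have mFT : measurable_fun setT (EFin \o (fun z => F z * \1_(tri c (Num.sqrt s)) z)).
    apply/measurable_EFinP/measurable_funM => //; apply: measurable_indic.
    exact: measurable_ideal_triangle_oo.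
  apply/integrableP; split=> //=.
  by rewrite integral_fin_num_abs ?T0//; exact/measurable_EFinP.
Qed.

(** Superposition over the centre [c].  Convolving a Gaussian of rate [b] with a
Gaussian of rate [d] gives the rate [b * d / (b + d)], and every rate [a < b] is
reached by a suitable [d]. *)
Lemma integral_height_eq0 a b m : 0 < a < b ->
  (\int[leb2]_z (F z * (gauss a m z.1 * height_factor b z.2))%:E = 0)%E.
Proof.
move=> /andP[a0 ab]; have b0 : 0 < b by exact: lt_trans ab.
pose d := a * b / (b - a).
have d0 : 0 < d by rewrite divr_gt0 ?mulr_gt0 ?subr_gt0.
have bd0 : 0 < b + d by exact: addr_gt0.
have bdE : b * d / (b + d) = a.
  have ba0 : 0 < b - a by rewrite subr_gt0.
  by rewrite /d; field; apply/andP; split; rewrite gt_eqF//; nra.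
set M := gauss_mass (b + d).
have M0 : 0 < M by exact: gauss_mass_gt0.
pose k (p : R * plane R) :=
  M^-1 * gauss d m p.1 * (gauss b p.1 p.2.1 * height_factor b p.2.2).
have m1 : measurable_fun setT (fun p : R * plane R => p.1 : R) by exact: measurable_fst.
have m21 : measurable_fun setT (fun p : R * plane R => p.2.1 : R).
  exact: (measurableT_comp measurable_fst measurable_snd).
apply: (@integral_mixture_eq0 _ _ (measurableTypeR R) (plane R) R leb leb2 F
  (fun z => gauss a m z.1 * height_factor b z.2) k) => //.
- apply: measurable_funM.
    apply: measurable_funM => //.
    exact: (measurableT_comp (measurable_gauss d m) m1).
  apply: measurable_funM; last first.
    exact: (measurableT_comp (measurable_height_factor b) measurable_snd).
  apply: measurableT_comp => //; apply: measurable_funM => //.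
  by apply: measurable_funX; exact: measurable_funB.
- move=> p; rewrite !mulr_ge0 ?invr_ge0 ?(ltW (gauss_gt0 _ _ _)) ?(ltW M0)//.
  by rewrite subr_ge0 gauss_le1.
- move=> z; rewrite /k /=.
  pose w := M^-1 * gauss a m z.1 * height_factor b z.2.
  transitivity (\int[leb]_c (w%:E *
      (gauss (b + d) ((b * z.1 + d * m) / (b + d)) c)%:E))%E.
    apply: eq_integral => c _; rewrite -EFinM; congr EFin.
    rewrite (gaussC b c) mulrA -[_ * gauss b _ _]mulrA (mulrC (gauss d m c)).
    by rewrite gaussM// bdE /w; ring.
  rewrite integralZl//; last exact: integrable_gauss.
  rewrite integral_gauss// -/M -EFinM; congr EFin.
  by rewrite /w; field; rewrite gt_eqF.
- exact: integrable_test.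
- move=> c.
  transitivity (\int[leb2]_z ((M^-1 * gauss d m c)%:E *
      (F z * (gauss b c z.1 * height_factor b z.2))%:E))%E.
    by apply: eq_integral => z _; rewrite -EFinM /k /=; congr EFin; ring.
  rewrite integralZl//; last exact: integrable_test.
  by rewrite integral_radial_eq0// mule0.
Qed.

(** The powers of [gauss 1 0 z.2] come from differences of height factors: the
[n]-th power times [height_factor 1] is the difference of the height factors of
rates [n + 1] and [n].  Only the rates above [a] are available. *)
Lemma integral_below_eq0 a m s : 0 < a -> 0 < s <= 1 ->
  (\int[leb2]_z (F z * (gauss a m z.1 * height_factor 1 z.2) *
    (s <= gauss 1 0 z.2)%R%:R)%:E = 0)%E.
Proof.
move=> a0 s01.
apply: (@integral_superlevel_eq0 _ _ _ leb2
  (fun z => F z * (gauss a m z.1 * height_factor 1 z.2))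
  (fun z => gauss 1 0 z.2) (Num.trunc a).+1) => //.
- exact: integrable_test.
- exact: (measurableT_comp (measurable_gauss 1 0) measurable_snd).
- by move=> z; rewrite gauss_le1// ltW// gauss_gt0.
move=> n an; have {an}an : a < n%:R.
  by apply: lt_le_trans (truncnS_gt a) _; rewrite ler_nat.
have n0 : 0 < n%:R :> R by exact: lt_trans an.
transitivity (\int[leb2]_z
    ((F z * (gauss a m z.1 * height_factor n.+1%:R z.2))%:E -
     (F z * (gauss a m z.1 * height_factor n%:R z.2))%:E))%E.
  apply: eq_integral => z _; rewrite -EFinB; congr EFin.
  by rewrite /height_factor -[n%:R]mul1r -[n.+1%:R]mul1r -!gaussX exprS; ring.
rewrite integralB//; [|exact: integrable_test|exact: integrable_test].
by rewrite !integral_height_eq0 ?sube0// a0//= (lt_trans an)// ltr_nat.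
Qed.

(** The powers of [gauss 1 m z.1] come from the product of two Gaussians in
[z.1], which is a multiple of a Gaussian with another centre. *)
Lemma integral_box_eq0 m s t : 0 < s <= 1 -> 0 < t <= 1 ->
  (\int[leb2]_z (F z * (gauss 1 0 z.1 * height_factor 1 z.2) *
    (s <= gauss 1 0 z.2)%R%:R * (t <= gauss 1 m z.1)%R%:R)%:E = 0)%E.
Proof.
move=> s01 t01.
have ms : measurable_fun setT (fun z => (s <= gauss 1 0 z.2)%R%:R : R).
  apply: measurable_natr_bool; apply: measurable_fun_ler => //.
  exact: (measurableT_comp (measurable_gauss 1 0) measurable_snd).
have s1 z : `|(s <= gauss 1 0 z.2)%R%:R : R| <= 1.
  by case: (s <= _); rewrite ?normr1// normr0.
apply: (@integral_superlevel_eq0 _ _ _ leb2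
  (fun z => F z * (gauss 1 0 z.1 * height_factor 1 z.2) * (s <= gauss 1 0 z.2)%R%:R)
  (fun z => gauss 1 m z.1) 0) => //.
- exact: integrable_testM.
- by move=> z; rewrite gauss_le1// ltW// gauss_gt0.
move=> n _; have n0 : 0 < 1 + n%:R :> R by rewrite ltr_pwDl.
transitivity (\int[leb2]_z ((gauss (1 * n%:R / (1 + n%:R)) m 0)%:E *
    (F z * (gauss (1 + n%:R) ((1 * 0 + n%:R * m) / (1 + n%:R)) z.1 *
       height_factor 1 z.2) * (s <= gauss 1 0 z.2)%R%:R)%:E))%E.
  apply: eq_integral => z _; rewrite -EFinM; congr EFin.
  rewrite gaussX [X in gauss X m z.1]mul1r.
  transitivity (F z * (gauss 1 0 z.1 * gauss n%:R m z.1 * height_factor 1 z.2) *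
      (s <= gauss 1 0 z.2)%R%:R); first by ring.
  by rewrite gaussM//; ring.
rewrite integralZl//; last exact: integrable_testM.
by rewrite integral_below_eq0// mule0.
Qed.

Let box_le_gauss (m r x : R) : 0 <= r -> (gauss 1 0 r <= gauss 1 m x) = (`|x - m| <= r).
Proof.
move=> r0; rewrite /gauss ler_expR !mulN1r lerN2 subr0.
by rewrite -[in LHS](real_normK (num_real (x - m))) ler_sqr ?nnegrE.
Qed.

(** The weight multiplying [F] in [w] makes [w] integrable and is positive on the
upper half-plane. *)
Lemma ae_eq0_of_triangles : {ae leb2, forall z, F z = 0}.
Proof.
pose w z := F z * (gauss 1 0 z.1 * height_factor 1 z.2).
suff : {ae leb2, forall z, w z = 0}.
  apply: filterS => z wz0; have [z0|z0] := leP z.2 0; first exact: F0.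
  move/eqP: wz0; rewrite /w !mulf_eq0 (gt_eqF (gauss_gt0 _ _ _))/=.
  case/orP => [/eqP//|]; rewrite /height_factor subr_eq0 eq_sym => /eqP h.
  have : gauss 1 0 z.2 < 1.
    by rewrite -[ltRHS]expR0 ltr_expR subr0 mulN1r oppr_lt0 exprn_gt0.
  by rewrite h ltxx.
apply: (@ae_eq0_pi_system _ _ _ leb2 (@boxes R) (@square R)) => //.
- exact: measurable_boxes.
- exact: boxes_setI_closed.
- by move=> n; exists (- n%:R), n%:R, n%:R.
- exact: square_cover.
- exact: integrable_test.
move=> _ [a [b [d ->]]]; rewrite integral_mul_indic.
have [ba|ab] := ltP b a.
  apply: integral0_eq => z _; rewrite indicE memNset ?mulr0// => /= /andP[/andP[h1 h2] _].
  by have := lt_le_trans ba (le_trans h1 h2); rewrite ltxx.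
have [d0|d0] := leP d 0.
  apply: integral0_eq => z _; rewrite indicE; have [z0|z0] := leP z.2 0.
    by rewrite /w F0// !mul0r.
  rewrite memNset ?mulr0// => /= /andP[_ zd].
  by have := lt_le_trans z0 (le_trans zd d0); rewrite ltxx.
have r0 : 0 <= (b - a) / 2 by lra.
have g01 r : 0 < gauss 1 0 r <= 1 by rewrite gauss_gt0 gauss_le1.
rewrite -[RHS](integral_box_eq0 ((a + b) / 2) (g01 d) (g01 ((b - a) / 2))).
apply: eq_integral => z _; have [z0|z0] := leP z.2 0.
  by rewrite /w F0// !mul0r.
rewrite /w -!mulrA; congr (_ * (_ * (_ * _)))%:E.
rewrite -natrM mulnb !box_le_gauss// ?(ltW d0)// subr0 gtr0_norm// indicE.
congr ((nat_of_bool _)%:R).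
have -> : (`|z.1 - (a + b) / 2| <= (b - a) / 2) = (a <= z.1 <= b).
  by rewrite ler_norml; apply/idP/idP => /andP[h1 h2]; apply/andP; split; lra.
by rewrite andbC; apply/idP/idP => [/set_mem//|h]; exact/mem_set.
Qed.

End Transform.

(** * The theorem *)

Section HypAreaDensity.
Context (R : realType).

Definition hyp_weight (z : plane R) : R := (0 < z.2)%R%:R / z.2 ^+ 2.

Lemma hyp_weight_ge0 z : 0 <= hyp_weight z.
Proof. by rewrite divr_ge0// exprn_even_ge0. Qed.

Lemma measurable_hyp_weight : measurable_fun setT hyp_weight.
Proof.
have mz2 : measurable_fun setT (fun z : plane R => z.2 : R) by exact: measurable_snd.
apply: measurable_funM.
  by apply: measurable_natr_bool; exact: measurable_fun_ltr.
rewrite (_ : (fun z => _) = (@powR R)^~ (-1) \o (fun z : plane R => z.2 ^+ 2)).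
  by apply: measurableT_comp; [exact: measurable_powR|exact: measurable_funX].
by apply/funext => z /=; rewrite powR_inv1 ?sqr_ge0.
Qed.

Lemma hyp_areaE (A : set (plane R)) : measurable A ->
  @hyp_area R A = (\int[@lebesgue2 R]_(z in A) (hyp_weight z)%:E)%E.
Proof.
move=> mA; rewrite /hyp_area integral_mkcondr; apply: eq_integral => z _.
rewrite patchE /hyp_weight; case: ifPn => [/set_mem z0|/negP z0].
  by have -> : 0 < z.2 = true := z0; rewrite mul1r.
have -> : (0 < z.2) = false by apply/negP => h; apply: z0; exact/mem_set.
by rewrite mul0r.
Qed.

End HypAreaDensity.

Theorem theorem4 (R : realType) (f : plane R -> R)
    (hf : f \in Lfun (@hyp_area R) +oo%E)
    (h0 : forall T : set (plane R), is_ideal_triangle T ->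
       (\int[@hyp_area R]_(z in T) (f z)%:E = 0)%E) :
  {ae @hyp_area R, forall z, f z = 0}.
Proof.
have mf : measurable_fun setT f by have /andP[/set_mem] := hf.
(* In a null space the sup norm is zero by convention and bounds nothing, but
   every property holds almost everywhere. *)
have [M0|M0] := eqVneq (@hyp_area R setT) 0%E.
  by exists setT; split=> //; exact: measurableT.
have [M fM] : exists M, \forall z \ae @hyp_area R, `|f z| <= M.
  apply: (@ess_supr_bounded _ _ _ _ (fun z => `|f z|)).
  have /andP[_ /set_mem] := hf.
  by rewrite /finite_norm /= unlock /Lnorm lt0e M0 measure_ge0.
(* The truncation [g] of [f] is bounded everywhere, as the domination of [F]
   requires. *)
pose C := `|M|.
pose g (z : plane R) := if `|f z| <= C then f z else 0.
have mg : measurable_fun setT g.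
  apply: measurable_fun_ifT => //; apply: measurable_fun_ler => //.
  exact: measurableT_comp.
have fg : \forall z \ae @hyp_area R, f z = g z.
  by apply: filterS fM => z fz; rewrite /g (le_trans fz (ler_norm M)).
have mw := @measurable_hyp_weight R; have w0 := @hyp_weight_ge0 R.
pose F (z : plane R) := g z * hyp_weight z.
have mF : measurable_fun setT F by exact: measurable_funM.
have F_tri c r : 0 < r -> (\int[@lebesgue2 R]_(z in
    ideal_triangle (Some (c - r)%R) (Some (c + r)%R) None) (F z)%:E = 0)%E.
  move=> r0; set T := ideal_triangle _ _ _.
  have mT : measurable T by exact: measurable_ideal_triangle_oo.
  rewrite integral_mul_indic.
  transitivity (\int[@lebesgue2 R]_z (g z * \1_T z * hyp_weight z)%:E)%E.
    by apply: eq_integral => z _; rewrite /F mulrAC.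
  rewrite -(integral_density mw w0 (@hyp_areaE R)); last first.
    by apply: measurable_funM => //; exact: measurable_indic.
  rewrite -integral_mul_indic.
  have T_ideal : is_ideal_triangle T.
    by exists (Some (c - r)), (Some (c + r)), None; split=> // -[]; lra.
  rewrite -[RHS](h0 _ T_ideal); apply: ae_eq_integral => //.
  - by apply: measurable_funTS; exact/measurable_EFinP.
  - by apply: measurable_funTS; exact/measurable_EFinP.
  - by apply: filterS fg => z -> _.
have F_ae : {ae @lebesgue2 R, forall z, F z = 0}.
  apply: (@ae_eq0_of_triangles R F C) => //.
  - by move=> z z0; rewrite /F /hyp_weight ltNge z0 mul0r mulr0.
  - move=> z z0; rewrite /F /hyp_weight z0 mul1r normrM [X in _ * X]ger0_norm ?invr_ge0 ?sqr_ge0//.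
    rewrite ler_wpM2r ?invr_ge0 ?sqr_ge0// /g; case: ifP => // _.
    by rewrite normr0 normr_ge0.
have F_ae_hyp : {ae @hyp_area R, forall z, F z = 0}.
  case: F_ae => N [mN N0 subN]; exists N; split=> //.
  rewrite hyp_areaE// null_set_integral//.
  by apply: measurable_funTS; exact/measurable_EFinP.
have H_ae : {ae @hyp_area R, forall z, 0 < z.2}.
  exists (~` @hplane R); split=> //; first exact: measurableC (@measurable_hplane R).
  by rewrite /hyp_area setICl integral_set0.
apply: filterS3 fg F_ae_hyp H_ae => z -> /eqP Fz z0.
move: Fz; rewrite /F /hyp_weight z0 mul1r mulf_eq0 invr_eq0 sqrf_eq0 (gt_eqF z0) orbF.
by move/eqP.
Qed.
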